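(* Let $d\ge2$, $\ell\ge0$ an integer, $0<R_1<R_2$, $\alpha_1,\alpha_2>0$, $\delta=R_2-R_1$, $R=\max(R_1,R_2)$, and let $$S_{\ell,d}(\alpha_1,\alpha_2)=\alpha_1+\alpha_2+K_{\ell,d}\frac{\delta}{R_1R_2},\qquad K_{\ell,d}=\frac{(2\ell+d-2)^2+4d-5}{8}.$$ Let $k_{\ell,1}<k_{\ell,2}<\cdots$ be the resonances of angular mode $\ell$. As $p\to\infty$, $$k_{\ell,p+1}-k_{\ell,p}=\frac\pi\delta\left[1-\frac{S_{\ell,d}(\alpha_1,\alpha_2)}{k_{\ell,p}^2\,\delta}+O\bigl((k_{\ell,p}R)^{-3}\bigr)\right].$$
   Context: The resonances $k_{\ell,1}<k_{\ell,2}<\cdots$ are the positive numbers $k$ for which $\lambda=k^2$ is an eigenvalue of the Robin problem $$u''+\frac{d-1}{r}u'+\Bigl(\lambda-\frac{\ell(\ell+d-2)}{r^2}\Bigr)u=0\ \text{ on }(R_1,R_2),\qquad -u'(R_1)+\alpha_1u(R_1)=0,\quad u'(R_2)+\alpha_2u(R_2)=0.$$ The parameters $d,\ell,R_1,R_2,\alpha_1,\alpha_2$ are fixed; the implied constant may depend on them. *)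

(* Defs.v *)
From Stdlib Require Import Reals.
From Coquelicot Require Import Coquelicot.
Open Scope R_scope.

(** [u] is taken of class C^1 on [[R1, R2]] and twice differentiable on
    [(R1, R2)].  Since [u] is a total function on [R] of which only the values
    on [[R1, R2]] matter, its first derivative [du] is the derivative relative
    to [[R1, R2]]: one-sided at [R1] and [R2], and the usual [is_derive] at
    interior points. *)
Definition robin_eigenfunction (d l : nat) (R1 R2 alpha1 alpha2 lambda : R)
    (u : R -> R) : Prop :=
  (exists r, R1 <= r <= R2 /\ u r <> 0) /\
  exists du ddu : R -> R,
    (forall r, R1 <= r <= R2 ->
       filterdiff u (within (fun s => R1 <= s <= R2) (locally r))
         (fun h => scal h (du r))) /\
    continuous_on (fun r => R1 <= r <= R2) du /\
    (forall r, R1 < r < R2 -> is_derive du r (ddu r)) /\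
    (forall r, R1 < r < R2 ->
       ddu r + (INR d - 1) / r * du r
       + (lambda - INR l * (INR l + INR d - 2) / r ^ 2) * u r = 0) /\
    - du R1 + alpha1 * u R1 = 0 /\
    du R2 + alpha2 * u R2 = 0.

Definition robin_eigenvalue (d l : nat) (R1 R2 alpha1 alpha2 lambda : R) : Prop :=
  exists u : R -> R, robin_eigenfunction d l R1 R2 alpha1 alpha2 lambda u.

Definition resonance (d l : nat) (R1 R2 alpha1 alpha2 k : R) : Prop :=
  0 < k /\ robin_eigenvalue d l R1 R2 alpha1 alpha2 (k ^ 2).

(** [k 1 < k 2 < ...] lists all resonances; the value [k 0] is irrelevant. *)
Definition resonance_sequence (d l : nat) (R1 R2 alpha1 alpha2 : R)
    (k : nat -> R) : Prop :=
  (forall p q : nat, (1 <= p < q)%nat -> k p < k q) /\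
  (forall x : R, resonance d l R1 R2 alpha1 alpha2 x <->
                 exists p : nat, (1 <= p)%nat /\ k p = x).

Definition K_coef (d l : nat) : R :=
  ((2 * INR l + INR d - 2) ^ 2 + 4 * INR d - 5) / 8.

Definition S_coef (d l : nat) (R1 R2 alpha1 alpha2 : R) : R :=
  alpha1 + alpha2 + K_coef d l * ((R2 - R1) / (R1 * R2)).

Definition is_bigO (f g : nat -> R) : Prop :=
  exists C : R, eventually (fun n => Rabs (f n) <= C * Rabs (g n)).

(* Main.v *)
Require Import Defs.
From Stdlib Require Import Reals Lra Lia Psatz ClassicalEpsilon.
From Coquelicot Require Import Coquelicot.
Open Scope R_scope.

(** The Liouville substitution [v = r^((d-1)/2) u] turns the radial equation into
    [v'' + (k^2 - V) v = 0] with [V = m / r^2] and Robin conditions [v' = h1 v] at [R1],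
    [v' = - h2 v] at [R2]. Writing [v = A cos phi], [v' = - k A sin phi], the phase solves
    [phi' = k - (V / k) cos^2 phi], [phi R1 = - atan (h1 / k)], and [k] is a resonance iff
    [Theta k = phi R2 - atan (h2 / k)] is a multiple of [PI]. For large [k] the phase exists by
    contraction, and [Theta k' - Theta k] is [(k' - k) delta] up to a small relative error, so
    that [Theta] is increasing and continuous and consecutive resonances have values of [Theta]
    differing by exactly [PI]. Removing the oscillating part of [cos^2 phi] gives
    [Theta k = k delta - S / k + O(k^-3)] at resonances, and subtracting two consecutive
    relations gives the gap. *)

(** * Clamping to an interval, and a mean value inequality *)

(** Precomposition with [clamp] extends a function known on [[a, b]] to the whole line. Continuity
    relative to [[a, b]] becomes two-sided continuity, so that results asking for the latter apply
    at the endpoints as well. *)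
Definition clamp (a b r : R) : R := Rmax a (Rmin b r).

Lemma clamp_bounds (a b r : R) : a <= b -> a <= clamp a b r <= b.
Proof.
  intros; unfold clamp, Rmax, Rmin.
  destruct (Rle_dec b r); destruct (Rle_dec a _); lra.
Qed.

Lemma clamp_id (a b r : R) : a <= r <= b -> clamp a b r = r.
Proof.
  intros; unfold clamp, Rmax, Rmin.
  destruct (Rle_dec b r); destruct (Rle_dec a _); lra.
Qed.

Lemma clamp_lipschitz (a b r s : R) : Rabs (clamp a b r - clamp a b s) <= Rabs (r - s).
Proof.
  unfold clamp, Rmax, Rmin.
  destruct (Rle_dec b r); destruct (Rle_dec b s);
  destruct (Rle_dec a _); try destruct (Rle_dec a _);
  unfold Rabs; repeat destruct Rcase_abs; lra.
Qed.

Lemma continuous_eps (f : R -> R) (x : R) :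
  continuous f x <-> forall eps : posreal, locally x (fun y => Rabs (f y - f x) < eps).
Proof. apply (@filterlim_locally _ R_UniformSpace (locally x) _ f (f x)). Qed.

Lemma continuous_clamp (a b r : R) : continuous (clamp a b) r.
Proof.
  apply continuous_eps; intros eps; exists eps; intros y Hy.
  eapply Rle_lt_trans; [apply clamp_lipschitz | exact Hy].
Qed.

Lemma continuous_clamp_comp (a b : R) (f : R -> R) (r : R) :
  a <= b -> continuous_on (fun s => a <= s <= b) f ->
  continuous (fun s => f (clamp a b s)) r.
Proof.
  intros ab Hf.
  unfold continuous.
  eapply filterlim_comp; [| exact (Hf (clamp a b r) (clamp_bounds _ _ _ ab))].
  intros P HP. unfold within in HP.
  generalize (continuous_clamp a b r _ HP). unfold filtermap.
  apply filter_imp; intros x Hx; apply Hx, clamp_bounds, ab.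
Qed.

Lemma Rabs_sub_le_of_derive (f df : R -> R) (a b M x y : R) :
  continuous_on (fun s => a <= s <= b) f ->
  (forall r, a < r < b -> is_derive f r (df r)) ->
  (forall r, a < r < b -> Rabs (df r) <= M) -> 0 <= M ->
  a <= x -> x <= y -> y <= b -> Rabs (f y - f x) <= M * (y - x).
Proof.
  intros Hc Hd HM M0 ax xy yb.
  set (g := fun s => f (clamp a b s)).
  (* The mean value point [c] may be an endpoint, where [df] is not controlled. The default [0]
     keeps the bound true there, since [0 <= M]. *)
  set (dg := fun s => if Rlt_dec a s then if Rlt_dec s b then df s else 0 else 0).
  assert (ab : a <= b) by lra.
  assert (gf : forall s, a <= s <= b -> g s = f s)
    by (intros s Hs; unfold g; rewrite clamp_id; auto).
  destruct (MVT_gen g x y dg) as [c [Hcxy E]].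
  - rewrite Rmin_left, Rmax_right by lra. intros s Hs.
    unfold dg; destruct (Rlt_dec a s); [|lra]; destruct (Rlt_dec s b); [|lra].
    apply is_derive_ext_loc with f; [|apply Hd; lra].
    apply (locally_interval _ s a b); simpl; try lra.
    intros t Ht1 Ht2; simpl in *; symmetry; apply gf; lra.
  - intros s _. apply continuity_pt_filterlim.
    exact (continuous_clamp_comp a b f s ab Hc).
  - rewrite <- !gf by lra. rewrite E, Rabs_mult, (Rabs_pos_eq (y - x)) by lra.
    apply Rmult_le_compat_r; [lra|].
    unfold dg; destruct (Rlt_dec a c); [destruct (Rlt_dec c b)|].
    + apply HM; lra.
    + rewrite Rabs_R0; lra.
    + rewrite Rabs_R0; lra.
Qed.

Lemma continuous_on_derive (f df : R -> R) (a b : R) :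
  (forall r, a <= r <= b -> is_derive f r (df r)) ->
  continuous_on (fun s => a <= s <= b) f.
Proof.
  intros H; apply continuous_on_forall; intros x Hx.
  apply (@ex_derive_continuous R_AbsRing R_NormedModule); exists (df x); auto.
Qed.

(** * Existence for a scalar equation by Picard iteration *)

Lemma ex_RInt_cont (g : R -> R) (a b : R) : (forall s, continuous g s) -> ex_RInt g a b.
Proof. intros H; apply (@ex_RInt_continuous R_CompleteNormedModule); intros; apply H. Qed.

Lemma is_derive_RInt_cont (g : R -> R) (a r : R) :
  (forall s, continuous g s) -> is_derive (fun x => RInt g a x) r (g r).
Proof.
  intros H. apply (is_derive_RInt g (fun x => RInt g a x) a r); [|apply H].
  apply filter_forall; intros x; apply (@RInt_correct R_CompleteNormedModule), ex_RInt_cont, H.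
Qed.

(* If [L (b - a) <= 1/2] the Picard map is a contraction for the sup norm on [[a, b]]. *)
Lemma picard (a b y0 L : R) (f : R -> R -> R) :
  a <= b -> 0 <= L -> L * (b - a) <= 1 / 2 ->
  (forall phi : R -> R, (forall s, continuous phi s) ->
     forall s, continuous (fun s => f s (phi s)) s) ->
  (forall s y z, Rabs (f s y - f s z) <= L * Rabs (y - z)) ->
  exists phi : R -> R, phi a = y0 /\
    forall r, a <= r <= b -> is_derive phi r (f r (phi r)).
Proof.
  intros ab L0 Lab Hf HL.
  (* The clamp makes [T phi] continuous on the whole line, so the iteration stays among globally
     continuous functions. *)
  set (T := fun (phi : R -> R) r => y0 + RInt (fun s => f s (phi s)) a (clamp a b r)).
  assert (Tc : forall phi, (forall s, continuous phi s) -> forall s, continuous (T phi) s).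
  { intros phi Hphi s. apply (@continuous_plus _ R_AbsRing R_NormedModule); [apply continuous_const|].
    apply (continuous_comp (clamp a b) (fun x => RInt (fun s => f s (phi s)) a x)); [apply continuous_clamp|].
    apply (@ex_derive_continuous R_AbsRing R_NormedModule).
    eexists; apply is_derive_RInt_cont; intros; apply Hf, Hphi. }
  assert (Tcontr : forall phi psi M, (forall s, continuous phi s) -> (forall s, continuous psi s) ->
    (forall r, a <= r <= b -> Rabs (phi r - psi r) <= M) -> forall r, Rabs (T phi r - T psi r) <= M / 2).
  { intros phi psi M Hphi Hpsi HM r. unfold T.
    assert (M0 : 0 <= M) by (eapply Rle_trans; [apply Rabs_pos | apply (HM a); lra]).
    pose proof (clamp_bounds a b r ab) as Hr.
    replace (_ - _) with (RInt (fun s => minus (f s (phi s)) (f s (psi s))) a (clamp a b r)).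
    2:{ rewrite (@RInt_minus R_CompleteNormedModule) by (apply ex_RInt_cont; intros; apply Hf; assumption).
        unfold minus, plus, opp; simpl; ring. }
    eapply Rle_trans; [apply (abs_RInt_le_const _ _ _ (L * M)); [lra| |]|].
    - apply ex_RInt_cont; intros s. apply (@continuous_minus _ R_AbsRing R_NormedModule); apply Hf; assumption.
    - intros t Ht. eapply Rle_trans; [apply HL|]. apply Rmult_le_compat_l; [lra|]. apply HM; lra.
    - replace (M / 2) with (1 / 2 * M) by field. rewrite <- Rmult_assoc.
      apply Rmult_le_compat_r; [lra|].
      eapply Rle_trans; [|exact Lab]. rewrite Rmult_comm. apply Rmult_le_compat_l; lra. }
  set (X := fun n => Nat.iter n T (fun _ => y0)).
  assert (Xc : forall n s, continuous (X n) s).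
  { induction n; intros s; [apply continuous_const|]. apply Tc, IHn. }
  assert (HB : exists B, forall r, a <= r <= b -> Rabs (X 1%nat r - X 0%nat r) <= B).
  { destruct (continuity_ab_maj (fun r => Rabs (X 1%nat r - X 0%nat r)) a b ab) as [x [Hx _]].
    - intros c _. apply continuity_pt_filterlim. apply (continuous_Rabs_comp (fun r => X 1%nat r - X 0%nat r)).
      apply (@continuous_minus _ R_AbsRing R_NormedModule); apply Xc.
    - eexists; exact Hx. }
  destruct HB as [B HB].
  assert (B0 : 0 <= B) by (eapply Rle_trans; [apply Rabs_pos | apply (HB a); lra]).
  assert (step : forall n r, a <= r <= b -> Rabs (X (S n) r - X n r) <= B / 2 ^ n).
  { induction n; intros r Hr; [simpl pow; rewrite Rdiv_1_r; apply HB, Hr|].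
    replace (B / 2 ^ S n) with (B / 2 ^ n / 2) by (simpl; field; apply pow_nonzero; lra).
    apply (Tcontr (X (S n)) (X n)); auto. }
  (* The subtracted term is the exact tail of the geometric series; keeping it is what lets the
     induction on [m] close. *)
  assert (cauchy : forall n m r, a <= r <= b -> Rabs (X (n + m)%nat r - X n r) <= 2 * B / 2 ^ n - 2 * B / 2 ^ (n + m)).
  { intros n m r Hr; induction m.
    - rewrite Nat.add_0_r, !Rminus_diag, Rabs_R0; lra.
    - rewrite Nat.add_succ_r.
      replace (X (S (n + m)) r - X n r) with ((X (S (n + m)) r - X (n + m)%nat r) + (X (n + m)%nat r - X n r)) by ring.
      eapply Rle_trans; [apply Rabs_triang|].
      pose proof (step (n + m)%nat r Hr).
      replace (2 * B / 2 ^ S (n + m)) with (B / 2 ^ (n + m)) by (simpl; field; apply pow_nonzero; lra).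
      replace (2 * B / 2 ^ (n + m)) with (2 * (B / 2 ^ (n + m))) in IHm by (field; apply pow_nonzero; lra).
      lra. }
  assert (small : forall eps : posreal, exists N, 2 * B / 2 ^ N < eps).
  { intros eps. destruct (pow_lt_1_zero (1 / 2) ltac:(rewrite Rabs_pos_eq; lra) (eps / (2 * B + 1))) as [N HN].
    - apply Rdiv_lt_0_compat; [apply eps|lra].
    - exists N. specialize (HN N (le_n N)).
      rewrite Rabs_pos_eq in HN by (apply pow_le; lra).
      apply (Rmult_lt_compat_r (2 * B + 1)) in HN; [|lra].
      replace (eps / (2 * B + 1) * (2 * B + 1)) with (pos eps) in HN by (field; lra).
      eapply Rle_lt_trans; [|exact HN].
      unfold Rdiv at 2. rewrite Rmult_1_l, pow_inv.
      unfold Rdiv. rewrite Rmult_comm. apply Rmult_le_compat_l; [|lra].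
      apply Rlt_le, Rinv_0_lt_compat, pow_lt; lra. }
  assert (Bpos : forall n, 0 <= 2 * B / 2 ^ n).
  { intros n. apply Rmult_le_pos; [lra|]. apply Rlt_le, Rinv_0_lt_compat, pow_lt; lra. }
  assert (lim : forall r, a <= r <= b -> ex_finite_lim_seq (fun n => X n r)).
  { intros r Hr. apply ex_lim_seq_cauchy_corr. intros eps.
    destruct (small (pos_div_2 eps)) as [N HN]. exists N. intros n m Hn Hm. simpl in HN.
    replace n with (N + (n - N))%nat by lia. replace m with (N + (m - N))%nat by lia.
    pose proof (cauchy N (n - N)%nat r Hr). pose proof (cauchy N (m - N)%nat r Hr).
    pose proof (Bpos (N + (n - N))%nat). pose proof (Bpos (N + (m - N))%nat).
    revert H H0. unfold Rabs; repeat destruct Rcase_abs; lra. }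
  set (phi := fun r => real (Lim_seq (fun n => X n (clamp a b r)))).
  assert (unif : forall n r, a <= r <= b -> Rabs (phi r - X n r) <= 2 * B / 2 ^ n).
  { intros n r Hr. unfold phi. rewrite clamp_id by auto.
    pose proof (Lim_seq_correct' _ (lim r Hr)) as HL'.
    set (l := real (Lim_seq (fun n => X n r))) in *.
    apply (is_lim_seq_incr_n _ n) in HL'.
    assert (H1 : is_lim_seq (fun m => Rabs (X (m + n)%nat r - X n r)) (Rabs (l - X n r))).
    { apply (is_lim_seq_abs _ (Finite (l - X n r))). apply is_lim_seq_minus'; [exact HL'|apply is_lim_seq_const]. }
    apply (is_lim_seq_le _ (fun _ => 2 * B / 2 ^ n) (Finite (Rabs (l - X n r))) (Finite (2 * B / 2 ^ n))) in H1; [exact H1| |apply is_lim_seq_const].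
    intros m. rewrite Nat.add_comm. pose proof (cauchy n m r Hr). pose proof (Bpos (n + m)%nat). lra. }
  assert (phic : forall s, continuous phi s).
  { intros s. apply continuous_eps; intros eps.
    destruct (small (mkposreal (eps / 3) ltac:(apply Rdiv_lt_0_compat; [apply eps|lra]))) as [N HN]; simpl in HN.
    assert (Hc : continuous (fun r => X N (clamp a b r)) s).
    { apply (continuous_comp (clamp a b) (X N)); [apply continuous_clamp|apply Xc]. }
    rewrite continuous_eps in Hc.
    generalize (Hc (mkposreal (eps / 3) ltac:(apply Rdiv_lt_0_compat; [apply eps|lra]))).
    apply filter_imp. intros y Hy; simpl in Hy.
    assert (E : forall r, phi r = phi (clamp a b r)).
    { intros r; unfold phi. rewrite (clamp_id a b (clamp a b r)); auto. apply clamp_bounds, ab. }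
    rewrite (E y), (E s).
    pose proof (unif N (clamp a b y) (clamp_bounds a b y ab)).
    pose proof (unif N (clamp a b s) (clamp_bounds a b s ab)).
    revert H H0 Hy. unfold Rabs; repeat destruct Rcase_abs; lra. }
  assert (fix_ : forall r, a <= r <= b -> phi r = T phi r).
  { intros r Hr. apply Rminus_diag_uniq.
    (* Both [phi r] and [T phi r] lie within [B / 2 ^ N] of [X (S N) r], so for large [N] a nonzero
       gap would be smaller than itself. *)
    destruct (Req_dec (phi r - T phi r) 0) as [|N0]; [assumption|exfalso].
    apply Rabs_pos_lt in N0.
    destruct (small (mkposreal _ N0)) as [N HN]; simpl in HN.
    pose proof (unif (S N) r Hr) as H1.
    pose proof (Tcontr (X N) phi (2 * B / 2 ^ N) (Xc N) phic
      ltac:(intros; rewrite Rabs_minus_sym; apply unif; auto) r) as H2.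
    change (T (X N) r) with (X (S N) r) in H2.
    replace (2 * B / 2 ^ S N) with (2 * B / 2 ^ N / 2) in H1 by (simpl; field; apply pow_nonzero; lra).
    revert H1 H2 HN. unfold Rabs; repeat destruct Rcase_abs; lra. }
  (* The witness is the unclamped integral: it agrees with [phi] on [[a, b]], but unlike [T phi],
     which is constant beyond [[a, b]], it has the right two-sided derivative at the endpoints. *)
  exists (fun r => y0 + RInt (fun s => f s (phi s)) a r); split.
  - rewrite (@RInt_point R_CompleteNormedModule). apply Rplus_0_r.
  - intros r Hr.
    replace (y0 + RInt (fun s => f s (phi s)) a r) with (phi r)
      by (rewrite fix_ by auto; unfold T; rewrite clamp_id; auto).
    rewrite <- (Rplus_0_l (f r (phi r))).
    apply (@is_derive_plus R_AbsRing R_NormedModule); [apply (@is_derive_const R_AbsRing R_NormedModule)|].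
    apply (is_derive_RInt_cont (fun s => f s (phi s))). intros; apply Hf, phic.
Qed.

(** * The phase equation *)

Lemma Rabs_sub_le_lipschitz (f df : R -> R) (M x y : R) :
  (forall r, is_derive f r (df r)) ->
  (forall r, Rmin x y < r < Rmax x y -> Rabs (df r) <= M) -> 0 <= M ->
  Rabs (f y - f x) <= M * Rabs (y - x).
Proof.
  intros Hd HM M0.
  destruct (Rle_dec x y) as [xy|yx].
  - rewrite (Rabs_pos_eq (y - x)) by lra. rewrite Rmin_left, Rmax_right in HM by lra.
    apply (Rabs_sub_le_of_derive f df x y); try lra; auto.
    apply (continuous_on_derive f df); auto.
  - rewrite Rabs_minus_sym, (Rabs_left1 (y - x)), Ropp_minus_distr by lra.
    rewrite Rmin_right, Rmax_left in HM by lra.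
    apply (Rabs_sub_le_of_derive f df y x); try lra; auto.
    apply (continuous_on_derive f df); auto.
Qed.

(* [is_derive_unique] in the eta-expanded form of the side conditions left by [auto_derive]. *)
Lemma Derive_eq (f : R -> R) (x l : R) : is_derive f x l -> Derive (fun y : R => f y) x = l.
Proof. exact (is_derive_unique f x l). Qed.

(** * Elementary bounds for sine, cosine and arctangent *)

Lemma Rabs_sin_le (x : R) : Rabs (sin x) <= Rabs x.
Proof.
  pose proof (Rabs_sub_le_lipschitz sin cos 1 0 x) as H.
  rewrite sin_0, !Rminus_0_r, Rmult_1_l in H. apply H; [apply is_derive_sin| |lra].
  intros r _. apply Rabs_le, COS_bound.
Qed.

Lemma Rabs_sin_le_1 (x : R) : Rabs (sin x) <= 1.
Proof. apply Rabs_le, SIN_bound. Qed.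

Lemma Rabs_cos_le_1 (x : R) : Rabs (cos x) <= 1.
Proof. apply Rabs_le, COS_bound. Qed.

(** The difference of squares equals [- sin (x + y) * sin (x - y)]. This gives the phase equation a
    Lipschitz constant of size [1 / k]. *)
Lemma Rabs_sub_cos_sqr_le (x y : R) : Rabs (cos x ^ 2 - cos y ^ 2) <= Rabs (x - y).
Proof.
  replace (cos x ^ 2 - cos y ^ 2) with (- (sin (x + y) * sin (x - y))).
  - rewrite Rabs_Ropp, Rabs_mult.
    rewrite <- (Rmult_1_l (Rabs (x - y))).
    apply Rmult_le_compat; try apply Rabs_pos; [apply Rabs_sin_le_1|apply Rabs_sin_le].
  - rewrite sin_plus, sin_minus.
    transitivity (cos x ^ 2 * (sin y * sin y) - (sin x * sin x) * cos y ^ 2); [ring|].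
    replace (sin x * sin x) with (1 - cos x * cos x) by (pose proof (sin2_cos2 x) as H; unfold Rsqr in H; lra).
    replace (sin y * sin y) with (1 - cos y * cos y) by (pose proof (sin2_cos2 y) as H; unfold Rsqr in H; lra).
    ring.
Qed.

Lemma cos_sqr_bounds (x : R) : 0 <= cos x ^ 2 <= 1.
Proof. pose proof (COS_bound x). nra. Qed.

Lemma Rabs_sub_atan_le (x y : R) : Rabs (atan y - atan x) <= Rabs (y - x).
Proof.
  rewrite <- (Rmult_1_l (Rabs (y - x))).
  apply (Rabs_sub_le_lipschitz atan (fun r => / (1 + r ^ 2))); [| |lra].
  { intros r. rewrite <- Rsqr_pow2. apply is_derive_atan. }
  intros r _. rewrite Rabs_pos_eq.
  - apply Rle_trans with (/ 1); [|rewrite Rinv_1; lra]. apply Rinv_le_contravar; [lra|nra].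
  - apply Rlt_le, Rinv_0_lt_compat; nra.
Qed.

Lemma Rabs_atan_le (x : R) : Rabs (atan x) <= Rabs x.
Proof. pose proof (Rabs_sub_atan_le 0 x) as H. rewrite atan_0, !Rminus_0_r in H. exact H. Qed.

(** The derivative [- r^2 / (1 + r^2)] of [atan r - r] is at most [x^2] in size between [0] and [x].
    The Robin angles [atan (h / k)] can thus be replaced by [h / k] up to [O(k^-3)]. *)
Lemma Rabs_atan_sub_id_le (x : R) : Rabs (atan x - x) <= Rabs x ^ 3.
Proof.
  pose proof (Rabs_sub_le_lipschitz (fun x => atan x - x) (fun r => / (1 + r ^ 2) - 1) (Rabs x ^ 2) 0 x) as H.
  simpl in H. rewrite atan_0, !Rminus_0_r in H.
  replace (Rabs x ^ 3) with (Rabs x * (Rabs x * 1) * Rabs x) by ring.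
  apply H.
  - intros r. apply (is_derive_minus atan (fun x => x)); [|apply (@is_derive_id R_AbsRing)].
    rewrite Rmult_1_r. apply is_derive_atan.
  - intros r Hr. rewrite !Rmult_1_r.
    assert (E : r * r <= Rabs x * Rabs x).
    { revert Hr. unfold Rmin, Rmax, Rabs. destruct (Rle_dec 0 x); destruct (Rcase_abs x); intros; nra. }
    replace (/ (1 + r * r) - 1) with (- (r * r / (1 + r * r))) by (field; nra).
    rewrite Rabs_Ropp, Rabs_pos_eq.
    + apply Rle_trans with (r * r); [|exact E].
      apply Rle_div_l; nra.
    + apply Rle_div_r; nra.
  - pose proof (Rabs_pos x); nra.
Qed.

(* Modified Pruefer phase: [v = A cos phi], [v' = - k A sin phi] for a solution of
   [v'' + (k^2 - V) v = 0] with [v' a = h * v a]. *)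
Definition is_phase (V : R -> R) (a b h k : R) (phi : R -> R) : Prop :=
  phi a = - atan (h / k) /\
  forall r, a <= r <= b -> is_derive phi r (k - V r / k * cos (phi r) ^ 2).

(** The right-hand side is Lipschitz in the phase with constant [c / k], so the contraction
    condition of [picard] turns into a lower bound on [k]. *)
Lemma phase_exists (V : R -> R) (a b h k c : R) :
  a <= b -> 0 < k -> continuous_on (fun s => a <= s <= b) V ->
  (forall r, a <= r <= b -> Rabs (V r) <= c) -> 2 * c * (b - a) <= k ->
  exists phi, is_phase V a b h k phi.
Proof.
  intros ab k0 Vc Vb Hk.
  destruct (picard a b (- atan (h / k)) (c / k)
    (fun s y => k - V (clamp a b s) / k * cos y ^ 2)) as [phi [H0 H1]].
  - exact ab.
  - apply Rle_div_r; [lra|]. rewrite Rmult_0_l.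
    eapply Rle_trans; [apply Rabs_pos|apply (Vb a); lra].
  - replace (c / k * (b - a)) with (c * (b - a) / k) by (field; lra).
    apply Rle_div_l; lra.
  - intros phi Hphi s.
    apply (@continuous_minus _ R_AbsRing R_NormedModule); [apply continuous_const|].
    apply (@continuous_mult _ R_AbsRing).
    + apply (@continuous_mult _ R_AbsRing); [|apply continuous_const].
      apply continuous_clamp_comp; auto.
    + apply (continuous_comp phi (fun y => cos y ^ 2)); [apply Hphi|].
      apply (@ex_derive_continuous R_AbsRing R_NormedModule). auto_derive; auto.
  - intros s y z.
    replace (_ - _) with (V (clamp a b s) / k * (cos z ^ 2 - cos y ^ 2)) by ring.
    rewrite Rabs_mult, (Rabs_minus_sym y z).
    apply Rmult_le_compat; try apply Rabs_pos; [|apply Rabs_sub_cos_sqr_le].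
    unfold Rdiv; rewrite Rabs_mult, (Rabs_pos_eq (/ k)) by (apply Rlt_le, Rinv_0_lt_compat, k0).
    apply Rmult_le_compat_r; [apply Rlt_le, Rinv_0_lt_compat, k0|].
    apply Vb, clamp_bounds, ab.
  - exists phi; split; [exact H0|]. intros r Hr. specialize (H1 r Hr).
    rewrite clamp_id in H1 by auto. exact H1.
Qed.

(** Let [chi] be the deviation of [phi' - phi] from its linear part and [M] its maximal size on
    [[a, b]]. Integrating the equation for [chi] bounds [M] by explicit small terms plus
    [c / k * (b - a) * M], and the last term is at most [M / 2]. Absorbing it produces the factors
    [2] in the bound. *)
Lemma phase_sub_estimate (V : R -> R) (a b h c k k' : R) (phi phi' : R -> R) :
  a <= b -> 0 < k -> k <= k' ->
  (forall r, a <= r <= b -> Rabs (V r) <= c) -> 2 * c * (b - a) <= k ->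
  is_phase V a b h k phi -> is_phase V a b h k' phi' ->
  forall r, a <= r <= b ->
    Rabs (phi' r - phi r - (k' - k) * (r - a)) <=
    (k' - k) * (2 * (Rabs h + c * (b - a)) / k ^ 2 + 2 * c * (b - a) ^ 2 / k).
Proof.
  intros ab k0 kk' Vb Hk [P0 P1] [Q0 Q1].
  set (D := k' - k). assert (D0 : 0 <= D) by (unfold D; lra).
  assert (c0 : 0 <= c) by (eapply Rle_trans; [apply Rabs_pos|apply (Vb a); lra]).
  set (chi := fun r => phi' r - phi r - D * (r - a)).
  set (dchi := fun r => V r / k * cos (phi r) ^ 2 - V r / k' * cos (phi' r) ^ 2).
  assert (Hd : forall r, a <= r <= b -> is_derive chi r (dchi r)).
  { intros r Hr. unfold chi, dchi.
    replace (V r / k * cos (phi r) ^ 2 - V r / k' * cos (phi' r) ^ 2) with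
      ((k' - V r / k' * cos (phi' r) ^ 2) - (k - V r / k * cos (phi r) ^ 2) - D) by (unfold D; ring).
    apply (is_derive_minus (fun r => phi' r - phi r) (fun r => D * (r - a))).
    - apply (is_derive_minus phi' phi); auto.
    - auto_derive; auto; ring. }
  destruct (continuity_ab_maj (fun r => Rabs (chi r)) a b ab) as [x [Hx xab]].
  { intros s Hs. apply continuity_pt_filterlim. apply (continuous_Rabs_comp chi).
    apply (@ex_derive_continuous R_AbsRing R_NormedModule). eexists; apply Hd, Hs. }
  set (M := Rabs (chi x)) in *. assert (M0 : 0 <= M) by apply Rabs_pos.
  assert (ik : / k' <= / k) by (apply Rinv_le_contravar; lra).
  assert (ik0 : 0 < / k') by (apply Rinv_0_lt_compat; lra).
  assert (dk : / k - / k' <= D / k ^ 2).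
  (* The difference is [D / (k * k')]: every error must keep the factor [D = k' - k], for the
     estimate to serve as a bound on difference quotients. *)
  { replace (/ k - / k') with (D / k * / k') by (unfold D; field; lra).
    replace (D / k ^ 2) with (D / k * / k) by (field; lra).
    apply Rmult_le_compat_l; [apply Rle_div_r; lra|exact ik]. }
  assert (Ha : Rabs (chi a) <= Rabs h * (D / k ^ 2)).
  { unfold chi. rewrite P0, Q0.
    replace (- atan (h / k') - - atan (h / k) - D * (a - a)) with (atan (h / k) - atan (h / k')) by ring.
    eapply Rle_trans; [apply Rabs_sub_atan_le|].
    replace (h / k - h / k') with (h * (/ k - / k')) by (unfold Rdiv; ring).
    rewrite Rabs_mult. apply Rmult_le_compat_l; [apply Rabs_pos|].
    rewrite Rabs_pos_eq; lra. }
  assert (Hb : forall r, a < r < b -> Rabs (dchi r) <= c * (D / k ^ 2) + c / k * (M + D * (b - a))).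
  { intros r Hr. unfold dchi.
    replace (_ - _) with (V r * ((/ k - / k') * cos (phi' r) ^ 2)
       + V r * / k * (cos (phi r) ^ 2 - cos (phi' r) ^ 2)) by (unfold Rdiv; ring).
    eapply Rle_trans; [apply Rabs_triang|]. apply Rplus_le_compat.
    - rewrite Rabs_mult. apply Rmult_le_compat; try apply Rabs_pos; [apply Vb; lra|].
      pose proof (cos_sqr_bounds (phi' r)).
      rewrite Rabs_pos_eq by (apply Rmult_le_pos; lra).
      apply Rle_trans with (2 := dk). rewrite <- Rmult_1_r. apply Rmult_le_compat_l; lra.
    - rewrite !Rabs_mult. apply Rmult_le_compat.
      + apply Rmult_le_pos; apply Rabs_pos.
      + apply Rabs_pos.
      + rewrite (Rabs_pos_eq (/ k)) by lra. apply Rmult_le_compat_r; [lra|]. apply Vb; lra.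
      + eapply Rle_trans; [apply Rabs_sub_cos_sqr_le|].
        replace (phi r - phi' r) with (- (chi r + D * (r - a))) by (unfold chi; ring).
        rewrite Rabs_Ropp. eapply Rle_trans; [apply Rabs_triang|].
        apply Rplus_le_compat; [apply Hx; lra|].
        rewrite Rabs_pos_eq by (apply Rmult_le_pos; lra). apply Rmult_le_compat_l; lra. }
  set (B := c * (D / k ^ 2) + c / k * (M + D * (b - a))) in *.
  assert (Dk0 : 0 <= D / k ^ 2) by (apply Rle_div_r; [apply pow_lt|]; lra).
  assert (ck0 : 0 <= c / k) by (apply Rle_div_r; lra).
  assert (Db0 : 0 <= D * (b - a)) by (apply Rmult_le_pos; lra).
  assert (B0 : 0 <= B).
  { unfold B. apply Rplus_le_le_0_compat; apply Rmult_le_pos; lra. }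
  assert (Hxa : Rabs (chi x - chi a) <= B * (b - a)).
  { apply Rle_trans with (B * (x - a)); [|apply Rmult_le_compat_l; lra].
    apply (Rabs_sub_le_of_derive chi dchi a b); try lra; auto.
    - apply (continuous_on_derive chi dchi); auto.
    - intros; apply Hd; lra. }
  assert (HM : M <= Rabs h * (D / k ^ 2) + B * (b - a)).
  { unfold M. replace (chi x) with ((chi x - chi a) + chi a) by ring.
    eapply Rle_trans; [apply Rabs_triang|]. lra. }
  assert (ckb : c / k * (b - a) <= 1 / 2).
  { replace (c / k * (b - a)) with (c * (b - a) / k) by (field; lra). apply Rle_div_l; lra. }
  intros r Hr. fold (chi r). eapply Rle_trans; [apply Hx, Hr|].
  replace (D * (2 * (Rabs h + c * (b - a)) / k ^ 2 + 2 * c * (b - a) ^ 2 / k)) with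
    (2 * (Rabs h * (D / k ^ 2) + c * (D / k ^ 2) * (b - a) + c / k * (b - a) * (D * (b - a)))) by (field; lra).
  (* Absorption: [B] contains [M], and this is its contribution to [HM]. *)
  assert (c / k * (b - a) * M <= 1 / 2 * M) by (apply Rmult_le_compat_r; lra).
  unfold B in HM. lra.
Qed.

(* [W] is an antiderivative of [V]. The two correction terms in [G] remove the oscillating
   part of the phase equation up to [O(k^-3)], as two integrations by parts would. *)
Lemma phase_asymptotics (V V1 V2 W : R -> R) (a b h1 h2 c c1 c2 k : R) (phi : R -> R) :
  a <= b -> 1 <= k ->
  (forall r, a <= r <= b -> is_derive W r (V r)) ->
  (forall r, a <= r <= b -> is_derive V r (V1 r)) ->
  (forall r, a <= r <= b -> is_derive V1 r (V2 r)) ->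
  (forall r, a <= r <= b -> Rabs (V r) <= c) ->
  (forall r, a <= r <= b -> Rabs (V1 r) <= c1) ->
  (forall r, a <= r <= b -> Rabs (V2 r) <= c2) ->
  is_phase V a b h1 k phi -> sin (phi b - atan (h2 / k)) = 0 ->
  Rabs (phi b - atan (h2 / k) - k * (b - a) + (h1 + h2 + (W b - W a) / 2) / k) <=
  ((c ^ 2 + c * c1 + c2) * (b - a) + Rabs h1 ^ 3 + Rabs h2 ^ 3 + c * (Rabs h1 + Rabs h2) + c1) / k ^ 3.
Proof.
  intros ab k1 HW HV HV1 Vb V1b V2b [P0 P1] HT.
  assert (c0 : 0 <= c) by (eapply Rle_trans; [apply Rabs_pos|apply (Vb a); lra]).
  assert (c10 : 0 <= c1) by (eapply Rle_trans; [apply Rabs_pos|apply (V1b a); lra]).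
  assert (c20 : 0 <= c2) by (eapply Rle_trans; [apply Rabs_pos|apply (V2b a); lra]).
  set (i := / k). assert (i0 : 0 < i) by (apply Rinv_0_lt_compat; lra).
  assert (i1 : i <= 1) by (unfold i; rewrite <- Rinv_1; apply Rinv_le_contravar; lra).
  assert (ki : k * i = 1) by (apply Rinv_r; lra).
  set (G := fun r => phi r - k * r + W r * (i / 2) + V r * sin (2 * phi r) * (i ^ 2 / 4)
     + V1 r * cos (2 * phi r) * (i ^ 3 / 8)).
  (* With [cos^2 = (1 + cos (2 phi)) / 2], the [W] term cancels the mean part. Inserting
     [phi' = k - V * i * cos^2] in the derivatives of the two corrections cancels the terms of order
     [i] and [i^2]; this is what remains. *)
  set (dG := fun r => i ^ 3 * (- V r * V r * (cos (phi r) ^ 2 * cos (2 * phi r)) / 2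
     + V1 r * V r * (i * cos (phi r) ^ 2 * sin (2 * phi r)) / 4 + V2 r * cos (2 * phi r) / 8)).
  assert (Hd : forall r, a <= r <= b -> is_derive G r (dG r)).
  { intros r Hr. pose proof (P1 r Hr) as E. pose proof (HW r Hr) as EW.
    pose proof (HV r Hr) as EV. pose proof (HV1 r Hr) as EV1.
    unfold G. auto_derive.
    - repeat split; eexists; eassumption.
    - rewrite (Derive_eq phi r _ E), (Derive_eq W r _ EW), (Derive_eq V r _ EV), (Derive_eq V1 r _ EV1).
      unfold dG, Rdiv at 1. fold i. rewrite (cos_2a_cos (phi r)).
      replace k with (/ i) by (unfold i; apply Rinv_inv). field. lra. }
  assert (Hb : forall r, a < r < b -> Rabs (dG r) <= (c ^ 2 + c * c1 + c2) * i ^ 3).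
  { intros r Hr. unfold dG.
    assert (i3 : 0 <= i ^ 3) by (apply pow_le; lra).
    rewrite Rabs_mult, (Rabs_pos_eq (i ^ 3)), Rmult_comm by exact i3.
    apply Rmult_le_compat_r; [exact i3|].
    assert (Hr' : a <= r <= b) by lra.
    pose proof (Vb r Hr') as v0. pose proof (V1b r Hr') as v1. pose proof (V2b r Hr') as v2.
    pose proof (cos_sqr_bounds (phi r)) as q.
    pose proof (Rabs_cos_le_1 (2 * phi r)) as q1. pose proof (Rabs_sin_le_1 (2 * phi r)) as q2.
    set (p := cos (phi r) ^ 2) in *. set (x := cos (2 * phi r)) in *. set (y := sin (2 * phi r)) in *.
    clearbody p x y.
    assert (A1 : Rabs (- V r * V r * (p * x)) <= c * c * (1 * 1)).
    { rewrite !Rabs_mult, Rabs_Ropp, (Rabs_pos_eq p) by lra.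
      apply Rmult_le_compat; [apply Rmult_le_pos; apply Rabs_pos|apply Rmult_le_pos; [lra|apply Rabs_pos]| |];
      apply Rmult_le_compat; try apply Rabs_pos; lra. }
    assert (A2 : Rabs (V1 r * V r * (i * p * y)) <= c1 * c * (1 * 1 * 1)).
    { rewrite !Rabs_mult, (Rabs_pos_eq p), (Rabs_pos_eq i) by lra.
      apply Rmult_le_compat; [apply Rmult_le_pos; apply Rabs_pos|repeat apply Rmult_le_pos; try lra; apply Rabs_pos| |].
      - apply Rmult_le_compat; try apply Rabs_pos; lra.
      - apply Rmult_le_compat; [apply Rmult_le_pos; lra|apply Rabs_pos| |lra].
        apply Rmult_le_compat; lra. }
    assert (A3 : Rabs (V2 r * x) <= c2 * 1).
    { rewrite Rabs_mult. apply Rmult_le_compat; try apply Rabs_pos; lra. }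
    assert (0 <= c * c) by nra. assert (0 <= c1 * c) by nra.
    apply Rabs_le_between in A1, A2, A3. apply Rabs_le. lra. }
  assert (G1 : Rabs (G b - G a) <= (c ^ 2 + c * c1 + c2) * i ^ 3 * (b - a)).
  { apply (Rabs_sub_le_of_derive G dG a b); try lra; auto.
    - apply (continuous_on_derive G dG); auto.
    - intros; apply Hd; lra.
    - assert (0 <= i ^ 3) by (apply pow_le; lra). apply Rmult_le_pos; nra. }
  set (t1 := atan (h1 / k)) in *. set (t2 := atan (h2 / k)) in *.
  assert (T1 : Rabs (t1 - h1 * i) <= Rabs h1 ^ 3 * i ^ 3).
  { pose proof (Rabs_atan_sub_id_le (h1 / k)) as E. unfold Rdiv in E. fold i in E.
    rewrite Rabs_mult, (Rabs_pos_eq i), Rpow_mult_distr in E by lra. exact E. }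
  assert (T2 : Rabs (t2 - h2 * i) <= Rabs h2 ^ 3 * i ^ 3).
  { pose proof (Rabs_atan_sub_id_le (h2 / k)) as E. unfold Rdiv in E. fold i in E.
    rewrite Rabs_mult, (Rabs_pos_eq i), Rpow_mult_distr in E by lra. exact E. }
  assert (S2 : forall h, Rabs (sin (2 * atan (h / k))) <= 2 * (Rabs h * i)).
  { intros h. eapply Rle_trans; [apply Rabs_sin_le|]. rewrite Rabs_mult, (Rabs_pos_eq 2) by lra.
    apply Rmult_le_compat_l; [lra|]. eapply Rle_trans; [apply Rabs_atan_le|].
    unfold Rdiv; fold i. rewrite Rabs_mult, (Rabs_pos_eq i); lra. }
  (* Here the quantization condition enters: since [sin (phi b - t2) = 0], [sin (2 * phi b)] is
     [sin (2 * t2)] up to sign, hence [O(1 / k)]. The boundary term of order [i^2] in [G] thus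
     becomes [O(k^-3)]; at [a] the initial phase does the same. *)
  assert (Sb : Rabs (sin (2 * phi b)) <= 2 * (Rabs h2 * i)).
  { replace (2 * phi b) with (2 * (phi b - t2) + 2 * t2) by ring.
    rewrite sin_plus, (sin_2a (phi b - t2)), HT, Rmult_0_r, !Rmult_0_l, Rplus_0_l, Rabs_mult.
    rewrite <- (Rmult_1_l (2 * (Rabs h2 * i))). apply Rmult_le_compat; try apply Rabs_pos;
    [apply Rabs_cos_le_1|apply S2]. }
  assert (Sa : Rabs (sin (2 * phi a)) <= 2 * (Rabs h1 * i)).
  { rewrite P0. replace (2 * - t1) with (- (2 * t1)) by ring. rewrite sin_neg, Rabs_Ropp. apply S2. }
  assert (B1 : Rabs (V b * sin (2 * phi b) * (i ^ 2 / 4)) <= c * (2 * (Rabs h2 * i)) * (i ^ 2 / 4)).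
  { assert (0 <= i ^ 2 / 4) by (pose proof (pow_le i 2); lra).
    rewrite !Rabs_mult, (Rabs_pos_eq (i ^ 2 / 4)) by auto. apply Rmult_le_compat_r; auto.
    apply Rmult_le_compat; try apply Rabs_pos; auto. apply Vb; lra. }
  assert (B2 : Rabs (V a * sin (2 * phi a) * (i ^ 2 / 4)) <= c * (2 * (Rabs h1 * i)) * (i ^ 2 / 4)).
  { assert (0 <= i ^ 2 / 4) by (pose proof (pow_le i 2); lra).
    rewrite !Rabs_mult, (Rabs_pos_eq (i ^ 2 / 4)) by auto. apply Rmult_le_compat_r; auto.
    apply Rmult_le_compat; try apply Rabs_pos; auto. apply Vb; lra. }
  assert (B3 : forall r, a <= r <= b -> Rabs (V1 r * cos (2 * phi r) * (i ^ 3 / 8)) <= c1 * 1 * (i ^ 3 / 8)).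
  { intros r Hr. assert (0 <= i ^ 3 / 8) by (pose proof (pow_le i 3); lra).
    rewrite !Rabs_mult, (Rabs_pos_eq (i ^ 3 / 8)) by auto. apply Rmult_le_compat_r; auto.
    apply Rmult_le_compat; try apply Rabs_pos; auto. apply Rabs_cos_le_1. }
  pose proof (B3 a ltac:(lra)) as B3a. pose proof (B3 b ltac:(lra)) as B3b.
  replace (phi b - t2 - k * (b - a) + (h1 + h2 + (W b - W a) / 2) / k) with
    ((G b - G a) - (t2 - h2 * i) - (t1 - h1 * i)
     - V b * sin (2 * phi b) * (i ^ 2 / 4) + V a * sin (2 * phi a) * (i ^ 2 / 4)
     - V1 b * cos (2 * phi b) * (i ^ 3 / 8) + V1 a * cos (2 * phi a) * (i ^ 3 / 8)).
  2:{ unfold G. rewrite P0. unfold Rdiv. fold i. ring. }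
  (* The sine boundary terms are counted twice and the [V1] terms rounded up from [c1 * i^3 / 4],
     which gives the simple constants of the statement. *)
  replace (_ / k ^ 3) with ((c ^ 2 + c * c1 + c2) * i ^ 3 * (b - a) + Rabs h2 ^ 3 * i ^ 3 + Rabs h1 ^ 3 * i ^ 3
    + (c * (2 * (Rabs h2 * i)) * (i ^ 2 / 4) + c * (2 * (Rabs h1 * i)) * (i ^ 2 / 4)) * 2 + c1 * i ^ 3).
  2:{ unfold i. field. lra. }
  assert (0 <= c1 * i ^ 3) by (apply Rmult_le_pos; [|apply pow_le]; lra).
  clear - B1 B2 B3a B3b T1 T2 G1 H.
  revert B1 B2 B3a B3b T1 T2 G1. unfold Rdiv.
  set (x1 := G b - G a). set (x2 := t2 - h2 * i). set (x3 := t1 - h1 * i).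
  set (x4 := V b * _ * _). set (x5 := V a * _ * _). set (x6 := V1 b * _ * _). set (x7 := V1 a * _ * _).
  intros.
  apply Rabs_le_between in B1, B2, B3a, B3b, T1, T2, G1.
  apply Rabs_le. lra.
Qed.

(** * From the phase to solutions of the linear equation *)

Lemma continuous_on_plus (D : R -> Prop) (f g : R -> R) :
  continuous_on D f -> continuous_on D g -> continuous_on D (fun r => f r + g r).
Proof.
  intros Hf Hg x Hx.
  exact (filterlim_comp_2 f g Rplus (Hf x Hx) (Hg x Hx) (@filterlim_plus R_AbsRing R_NormedModule (f x) (g x))).
Qed.

Lemma continuous_on_mult (D : R -> Prop) (f g : R -> R) :
  continuous_on D f -> continuous_on D g -> continuous_on D (fun r => f r * g r).
Proof.
  intros Hf Hg x Hx.
  exact (filterlim_comp_2 f g Rmult (Hf x Hx) (Hg x Hx) (@filterlim_mult R_AbsRing (f x) (g x))).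
Qed.

Lemma continuous_on_opp (D : R -> Prop) (f : R -> R) :
  continuous_on D f -> continuous_on D (fun r => - f r).
Proof.
  intros Hf x Hx.
  exact (filterlim_comp _ _ _ f Ropp _ _ _ (Hf x Hx) (@filterlim_opp R_AbsRing R_NormedModule (f x))).
Qed.

Lemma continuous_on_filterdiff_within (D : R -> Prop) (f : R -> R) (df : R -> R) :
  (forall r, D r -> filterdiff f (within D (locally r)) (fun h => scal h (df r))) ->
  continuous_on D f.
Proof.
  intros H x Hx.
  apply (@filterdiff_continuous_aux R_AbsRing R_NormedModule R_NormedModule (within D (locally x))
    (within_filter _ D _ _) f).
  - eexists; apply H, Hx.
  - intros P HP. unfold within. revert HP; apply filter_imp; auto.
Qed.

(** [filterdiff] quantifies over every limit of the filter; this identifies that limit as [r]. A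
    limit [x <> r] would force [r] itself to be closer to [x] than half their distance. *)
Lemma is_filter_lim_within_unique (D : R -> Prop) (r x : R) :
  D r -> is_filter_lim (within D (locally r)) x -> x = r.
Proof.
  intros Dr H. destruct (Req_dec x r) as [|N]; [assumption|exfalso].
  assert (N0 : 0 < Rabs (x - r) / 2) by (assert (0 < Rabs (x - r)) by (apply Rabs_pos_lt; lra); lra).
  pose proof (H (fun y => Rabs (y - x) < Rabs (x - r) / 2)) as H1.
  assert (H2 : locally x (fun y => Rabs (y - x) < Rabs (x - r) / 2)) by (exists (mkposreal _ N0); intros y Hy; exact Hy).
  specialize (H1 H2). apply locally_singleton in H1. specialize (H1 Dr).
  rewrite Rabs_minus_sym in H1. lra.
Qed.

Lemma filterdiff_within_derive (D : R -> Prop) (f : R -> R) (r l : R) :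
  D r -> is_derive f r l -> filterdiff f (within D (locally r)) (fun h => scal h l).
Proof.
  intros Dr [Hl Hf]. split; [exact Hl|]. intros x Hx.
  rewrite (is_filter_lim_within_unique D r x Dr Hx).
  intros eps. generalize (Hf r (fun P HP => HP) eps). unfold within. apply filter_imp; auto.
Qed.

Lemma is_derive_filterdiff_within (D : R -> Prop) (f : R -> R) (r l : R) :
  locally r D -> filterdiff f (within D (locally r)) (fun h => scal h l) -> is_derive f r l.
Proof.
  intros Dr [Hl Hf]. split; [exact Hl|]. intros x Hx eps.
  assert (Hx' : is_filter_lim (within D (locally r)) x).
  { intros P HP. unfold within. generalize (Hx P HP). apply (@filter_imp _ (locally r) _); auto. }
  generalize (@filter_and _ (locally r) _ _ _ Dr (Hf x Hx' eps)).
  apply (@filter_imp _ (locally r) _). intros y [H1 H2]; exact (H2 H1).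
Qed.

Lemma is_derive_Rpower_base (y r : R) :
  0 < r -> is_derive (fun x => Rpower x y) r (y / r * Rpower r y).
Proof. intros Hr. unfold Rpower. auto_derive; [exact Hr|]. field; lra. Qed.

Lemma sin_atan_cos_atan (x : R) : sin (atan x) = x * cos (atan x).
Proof.
  pose proof (atan_bound x) as B.
  assert (C : 0 < cos (atan x)) by (apply cos_gt_0; lra).
  pose proof (tan_atan x) as T. unfold tan in T.
  apply (f_equal (fun z => z * cos (atan x))) in T.
  rewrite <- T. field. lra.
Qed.

Lemma cos_atan_pos (x : R) : 0 < cos (atan x).
Proof. pose proof (atan_bound x) as B. apply cos_gt_0; lra. Qed.

(** * The amplitude and the reconstruction of solutions *)

(** This logarithmic derivative is the one for which [A cos phi] has derivative [- k A sin phi],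
    given the phase equation. *)
Definition is_amplitude (V : R -> R) (a b k : R) (phi A : R -> R) : Prop :=
  forall r, a <= r <= b ->
    0 < A r /\ is_derive A r (- (V r / k * sin (phi r) * cos (phi r)) * A r).

(** The equation is linear in [A], so the exponential of an integral solves it and is positive. *)
Lemma amplitude_exists (V : R -> R) (a b k : R) (phi : R -> R) :
  a <= b -> continuous_on (fun s => a <= s <= b) V ->
  continuous_on (fun s => a <= s <= b) phi ->
  exists A, is_amplitude V a b k phi A.
Proof.
  intros ab HV Hphi.
  set (g := fun r => - (V (clamp a b r) / k * sin (phi (clamp a b r)) * cos (phi (clamp a b r)))).
  assert (gc : forall s, continuous g s).
  { intros s. unfold g.
    apply (@continuous_opp _ R_AbsRing R_NormedModule).
    apply (@continuous_mult _ R_AbsRing); [apply (@continuous_mult _ R_AbsRing)|].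
    - apply (@continuous_mult _ R_AbsRing); [|apply continuous_const].
      apply continuous_clamp_comp; auto.
    - apply (continuous_comp (fun r => phi (clamp a b r)) sin); [apply continuous_clamp_comp; auto|apply continuous_sin].
    - apply (continuous_comp (fun r => phi (clamp a b r)) cos); [apply continuous_clamp_comp; auto|apply continuous_cos]. }
  exists (fun r => exp (RInt g a r)). intros r Hr; split; [apply exp_pos|].
  replace (- _ * _) with (scal (g r) (exp (RInt g a r)))
    by (unfold g at 1; rewrite clamp_id by auto; reflexivity).
  apply (is_derive_comp exp (fun x => RInt g a x)); [apply is_derive_exp|apply is_derive_RInt_cont, gc].
Qed.

(* The coordinates [s], proportional to the Wronskian of the two solutions, and [c] of
   [(v, dv)] along the solution built from [phi] and [A] are both constant, and [s] vanishes at [a]. *)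
Lemma solution_eq_phase_amplitude (V : R -> R) (a b h k : R) (phi A v dv : R -> R) :
  a <= b -> 0 < k -> is_phase V a b h k phi -> is_amplitude V a b k phi A ->
  continuous_on (fun s => a <= s <= b) v -> continuous_on (fun s => a <= s <= b) dv ->
  (forall r, a < r < b -> is_derive v r (dv r)) ->
  (forall r, a < r < b -> is_derive dv r ((V r - k ^ 2) * v r)) ->
  dv a = h * v a ->
  exists c, forall r, a <= r <= b ->
    v r = c * A r * cos (phi r) /\ dv r = - k * (c * A r * sin (phi r)).
Proof.
  intros ab k0 [P0 P1] HA vc dvc Hv Hdv Ha.
  assert (phic : continuous_on (fun s => a <= s <= b) phi).
  { apply (continuous_on_derive phi (fun r => k - V r / k * cos (phi r) ^ 2)), P1. }
  assert (sinc : continuous_on (fun s => a <= s <= b) (fun r => sin (phi r))).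
  { intros x Hx. exact (filterlim_comp _ _ _ phi sin _ _ _ (phic x Hx) (continuous_sin (phi x))). }
  assert (cosc : continuous_on (fun s => a <= s <= b) (fun r => cos (phi r))).
  { intros x Hx. exact (filterlim_comp _ _ _ phi cos _ _ _ (phic x Hx) (continuous_cos (phi x))). }
  assert (Ac : continuous_on (fun s => a <= s <= b) A).
  { apply (continuous_on_derive A (fun r => - (V r / k * sin (phi r) * cos (phi r)) * A r)).
    intros; apply HA; auto. }
  assert (kc : continuous_on (fun s => a <= s <= b) (fun _ => / k)).
  { apply continuous_on_forall; intros; apply continuous_const. }
  set (s := fun r => (v r * sin (phi r) + dv r * / k * cos (phi r)) * A r).
  set (c := fun r => (v r * cos (phi r) + - (dv r * / k * sin (phi r))) * / A r).
  assert (s0 : forall r, a <= r <= b -> s r = 0).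
  { assert (Hd : forall r, a < r < b -> is_derive s r 0).
    { intros r Hr. assert (Hr' : a <= r <= b) by lra.
      pose proof (Hv r Hr) as E1. pose proof (Hdv r Hr) as E2. pose proof (P1 r Hr') as E3.
      destruct (HA r Hr') as [_ E4]. unfold s. auto_derive.
      - repeat split; eexists; eassumption.
      - rewrite (Derive_eq v r _ E1), (Derive_eq dv r _ E2), (Derive_eq phi r _ E3), (Derive_eq A r _ E4).
        pose proof (sin2_cos2 (phi r)) as Q. unfold Rsqr in Q.
        set (x := cos (phi r)) in *. set (y := sin (phi r)) in *.
        replace (_ + _) with ((V r / k * v r * A r * x) * (1 - (y * y + x * x))) by (field; lra).
        rewrite Q; ring. }
    intros r Hr.
    assert (Rabs (s r - s a) <= 0 * (r - a)).
    { apply (Rabs_sub_le_of_derive s (fun _ => 0) a b); try lra; auto.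
      - repeat first [apply continuous_on_mult | apply continuous_on_plus]; auto.
      - intros; rewrite Rabs_R0; lra. }
    assert (sa : s a = 0).
    (* The initial phase [- atan (h / k)] encodes exactly the condition [dv a = h * v a]. *)
    { unfold s. rewrite P0, Ha, sin_neg, cos_neg, sin_atan_cos_atan. field. lra. }
    rewrite sa, Rminus_0_r, Rmult_0_l in H. apply Rabs_eq_0. pose proof (Rabs_pos (s r)); lra. }
  assert (cc : forall r, a <= r <= b -> c r = c a).
  { assert (Hd : forall r, a < r < b -> is_derive c r 0).
    { intros r Hr. assert (Hr' : a <= r <= b) by lra.
      pose proof (Hv r Hr) as E1. pose proof (Hdv r Hr) as E2. pose proof (P1 r Hr') as E3.
      destruct (HA r Hr') as [A0 E4]. pose proof (s0 r Hr') as Es. unfold s in Es.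
      unfold c. auto_derive.
      - repeat split; try (eexists; eassumption). lra.
      - rewrite (Derive_eq v r _ E1), (Derive_eq dv r _ E2), (Derive_eq phi r _ E3), (Derive_eq A r _ E4).
        pose proof (sin2_cos2 (phi r)) as Q. unfold Rsqr in Q.
        set (x := cos (phi r)) in *. set (y := sin (phi r)) in *.
        (* Unlike that of [s], the derivative of [c] vanishes only because [s] is already known to
           be zero: it combines the bracket in [s] with [sin^2 + cos^2 - 1]. *)
        assert (Es' : v r * y = - (dv r * / k * x)).
        { apply Rmult_integral in Es; destruct Es; lra. }
        transitivity (V r / k * / A r * ((v r * y + dv r * / k * x) * (x * x - y * y)
           + v r * y * (y * y + x * x - 1))); [field; lra|].
        rewrite Q, Es'. ring. }
    intros r Hr.
    assert (Rabs (c r - c a) <= 0 * (r - a)).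
    { apply (Rabs_sub_le_of_derive c (fun _ => 0) a b); try lra; auto.
      - assert (Aic : continuous_on (fun s => a <= s <= b) (fun r => / A r)).
        { intros x Hx. destruct (HA x Hx) as [A0 _].
          refine (filterlim_comp _ _ _ A Rinv _ _ _ (Ac x Hx) _).
          apply (@ex_derive_continuous R_AbsRing R_NormedModule). auto_derive. lra. }
        repeat first [apply continuous_on_mult | apply continuous_on_plus | apply continuous_on_opp]; auto.
      - intros; rewrite Rabs_R0; lra. }
    rewrite Rmult_0_l in H. apply Rminus_diag_uniq, Rabs_eq_0. pose proof (Rabs_pos (c r - c a)); lra. }
  exists (c a). intros r Hr. rewrite <- (cc r Hr).
  destruct (HA r Hr) as [A0 _]. pose proof (s0 r Hr) as Es. unfold s in Es.
  pose proof (sin2_cos2 (phi r)) as Q. unfold Rsqr in Q.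
  assert (Es' : v r * sin (phi r) = - (dv r * / k * cos (phi r))).
  { apply Rmult_integral in Es; destruct Es; lra. }
  unfold c. set (x := cos (phi r)) in *. set (y := sin (phi r)) in *. split.
  - replace (_ * x) with (v r * (x * x) - y * (dv r * / k * x)) by (field; lra).
    replace (dv r * / k * x) with (- (v r * y)) by lra.
    replace (x * x) with (1 - y * y) by lra. ring.
  - replace (- k * _) with (- k * (x * (v r * y)) + dv r * (y * y)) by (field; lra).
    rewrite Es'. replace (y * y) with (1 - x * x) by lra. field. lra.
Qed.

(** * Resonances in terms of the phase *)

(* The substitution [v = r^((d-1)/2) u] turns the radial equation into
   [v'' + (k^2 - liouville_coef d l / r^2) v = 0]. *)
Definition liouville_coef (d l : nat) : R :=
  INR l * (INR l + INR d - 2) + (INR d - 1) / 2 * ((INR d - 1) / 2 - 1).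

Lemma resonance_phase (d l : nat) (R1 R2 alpha1 alpha2 k : R) (phi : R -> R) :
  0 < R1 -> R1 < R2 -> 0 < k ->
  is_phase (fun r => liouville_coef d l / r ^ 2) R1 R2 (alpha1 + (INR d - 1) / 2 / R1) k phi ->
  resonance d l R1 R2 alpha1 alpha2 k ->
  sin (phi R2 - atan ((alpha2 - (INR d - 1) / 2 / R2) / k)) = 0.
Proof.
  intros R10 R12 k0 Hphi [_ [u [[r0 [Hr0 Hu0]] [du [ddu [Hu [duc [Hdu [Hode [Hb1 Hb2]]]]]]]]]].
  set (m := liouville_coef d l) in *. set (be := (INR d - 1) / 2) in *.
  set (v := fun r => Rpower r be * u r).
  set (dv := fun r => Rpower r be * (du r + be * (/ r * u r))).
  assert (Vc : continuous_on (fun s => R1 <= s <= R2) (fun r => m / r ^ 2)).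
  { apply (continuous_on_derive _ (fun r => - 2 * m / r ^ 3)). intros r Hr.
    auto_derive; [nra|]. field; lra. }
  destruct (amplitude_exists (fun r => m / r ^ 2) R1 R2 k phi) as [A HA]; [lra|exact Vc| |].
  { destruct Hphi as [_ P1]. apply (continuous_on_derive _ _ _ _ P1). }
  assert (uc : continuous_on (fun s => R1 <= s <= R2) u).
  { apply (continuous_on_filterdiff_within _ u du), Hu. }
  assert (pc : continuous_on (fun s => R1 <= s <= R2) (fun r => Rpower r be)).
  { apply (continuous_on_derive _ (fun r => be / r * Rpower r be)). intros r Hr.
    apply is_derive_Rpower_base; lra. }
  assert (du_u : forall r, R1 < r < R2 -> is_derive u r (du r)).
  { intros r Hr. apply (is_derive_filterdiff_within (fun s => R1 <= s <= R2)).
    - apply (locally_interval _ r R1 R2); simpl; try lra. intros; simpl in *; lra.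
    - apply Hu; lra. }
  destruct (solution_eq_phase_amplitude (fun r => m / r ^ 2) R1 R2 (alpha1 + be / R1) k phi A v dv)
    as [c Hc]; try assumption.
  - lra.
  - apply continuous_on_mult; assumption.
  - apply continuous_on_mult; [assumption|]. apply continuous_on_plus; [assumption|].
    apply continuous_on_mult; [apply continuous_on_forall; intros; apply continuous_const|].
    apply continuous_on_mult; [|assumption].
    apply (continuous_on_derive _ (fun r => - / r ^ 2)). intros r Hr.
    auto_derive; [lra|]. field; lra.
  - intros r Hr. pose proof (du_u r Hr) as E1. pose proof (is_derive_Rpower_base be r ltac:(lra)) as E2.
    unfold v. auto_derive.
    + repeat split; eexists; eassumption.
    + rewrite (Derive_eq u r _ E1), (Derive_eq (fun x => Rpower x be) r _ E2). unfold dv. field; lra.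
  - intros r Hr. pose proof (du_u r Hr) as E1. pose proof (Hdu r Hr) as E3.
    pose proof (is_derive_Rpower_base be r ltac:(lra)) as E2.
    unfold dv. auto_derive.
    + repeat split; try (eexists; eassumption). lra.
    + rewrite (Derive_eq u r _ E1), (Derive_eq (fun x => Rpower x be) r _ E2), (Derive_eq du r _ E3).
      pose proof (Hode r Hr) as E.
      replace (ddu r) with (- (2 * be / r * du r) - (k ^ 2 - INR l * (INR l + INR d - 2) / r ^ 2) * u r)
        by (unfold be; lra).
      unfold v, m, liouville_coef. fold be. field; lra.
  - unfold dv, v. replace (du R1) with (alpha1 * u R1) by lra. field; lra.
  (* If [c] were zero, [u] would vanish at [r0], against nontriviality. *)
  - assert (c0 : c <> 0).
    { intros c0. apply Hu0. destruct (Hc r0 Hr0) as [E _]. rewrite c0 in E. unfold v in E.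
      assert (0 < Rpower r0 be) by apply exp_pos.
      apply (Rmult_eq_reg_l (Rpower r0 be)); lra. }
    destruct (Hc R2) as [E1 E2]; [lra|]. unfold v in E1. unfold dv in E2.
    destruct (HA R2) as [A0 _]; [lra|].
    set (h2 := alpha2 - be / R2).
    assert (E : k * sin (phi R2) = h2 * cos (phi R2)).
    { apply (Rmult_eq_reg_l (c * A R2)); [|apply Rmult_integral_contrapositive_currified; lra].
      transitivity (- (- k * (c * A R2 * sin (phi R2)))); [ring|]. rewrite <- E2.
      transitivity (h2 * (c * A R2 * cos (phi R2))); [|ring]. rewrite <- E1. unfold h2.
      replace (du R2) with (- (alpha2 * u R2)) by lra. field; lra. }
    rewrite sin_minus, sin_atan_cos_atan.
    transitivity (cos (atan (h2 / k)) / k * (k * sin (phi R2) - h2 * cos (phi R2))); [field; lra|].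
    rewrite E; ring.
Qed.

(** Undoing the Liouville substitution, [r^(-be) * A * cos phi] is an eigenfunction; the initial
    phase gives the condition at [R1] and the sine condition the one at [R2]. *)
Lemma phase_resonance (d l : nat) (R1 R2 alpha1 alpha2 k : R) (phi : R -> R) :
  0 < R1 -> R1 < R2 -> 0 < k ->
  is_phase (fun r => liouville_coef d l / r ^ 2) R1 R2 (alpha1 + (INR d - 1) / 2 / R1) k phi ->
  sin (phi R2 - atan ((alpha2 - (INR d - 1) / 2 / R2) / k)) = 0 ->
  resonance d l R1 R2 alpha1 alpha2 k.
Proof.
  intros R10 R12 k0 [P0 P1] HT. split; [exact k0|].
  set (m := liouville_coef d l) in *. set (be := (INR d - 1) / 2) in *.
  assert (Vc : continuous_on (fun s => R1 <= s <= R2) (fun r => m / r ^ 2)).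
  { apply (continuous_on_derive _ (fun r => - 2 * m / r ^ 3)). intros r Hr.
    auto_derive; [nra|]. field; lra. }
  destruct (amplitude_exists (fun r => m / r ^ 2) R1 R2 k phi) as [A HA]; [lra|exact Vc| |].
  { apply (continuous_on_derive _ _ _ _ P1). }
  set (u := fun r => Rpower r (- be) * (A r * cos (phi r))).
  set (du := fun r => Rpower r (- be) * (- k * (A r * sin (phi r)) + - (be * (/ r * (A r * cos (phi r)))))).
  (* [ddu] is read off the radial equation, which then holds by definition; the content moves to
     showing that it is the derivative of [du]. *)
  set (ddu := fun r => - (2 * be / r * du r) - (k ^ 2 - INR l * (INR l + INR d - 2) / r ^ 2) * u r).
  assert (Hu : forall r, R1 <= r <= R2 -> is_derive u r (du r)).
  { intros r Hr. pose proof (is_derive_Rpower_base (- be) r ltac:(lra)) as E1.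
    destruct (HA r Hr) as [_ E2]. pose proof (P1 r Hr) as E3.
    unfold u. auto_derive.
    - repeat split; eexists; eassumption.
    - rewrite (Derive_eq (fun x => Rpower x (- be)) r _ E1), (Derive_eq A r _ E2), (Derive_eq phi r _ E3).
      unfold du. field; lra. }
  assert (Hdu : forall r, R1 <= r <= R2 -> is_derive du r (ddu r)).
  { intros r Hr. pose proof (is_derive_Rpower_base (- be) r ltac:(lra)) as E1.
    destruct (HA r Hr) as [_ E2]. pose proof (P1 r Hr) as E3.
    unfold du at 1. auto_derive.
    - repeat split; try (eexists; eassumption). lra.
    - rewrite (Derive_eq (fun x => Rpower x (- be)) r _ E1), (Derive_eq A r _ E2), (Derive_eq phi r _ E3).
      unfold ddu, du, u.
      pose proof (sin2_cos2 (phi r)) as Q. unfold Rsqr in Q.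
      set (x := cos (phi r)) in *. set (y := sin (phi r)) in *.
      apply Rminus_diag_uniq.
      transitivity (m / r ^ 2 * Rpower r (- be) * A r * x * (y * y + x * x - 1)).
      + unfold m, liouville_coef. fold be. field; lra.
      + rewrite Q; ring. }
  exists u. split.
  (* [phi R1] is minus an arctangent, so its cosine is positive and [u R1 > 0]. *)
  - exists R1. split; [lra|]. unfold u. rewrite P0, cos_neg.
    destruct (HA R1) as [A0 _]; [lra|].
    pose proof (cos_atan_pos ((alpha1 + be / R1) / k)).
    assert (0 < Rpower R1 (- be)) by apply exp_pos.
    apply Rgt_not_eq. apply Rmult_lt_0_compat; [assumption|]. apply Rmult_lt_0_compat; assumption.
  - exists du, ddu. split; [|split; [|split; [|split; [|split]]]].
    + intros r Hr. apply (filterdiff_within_derive (fun s => R1 <= s <= R2) u r (du r)); auto.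
    + apply (continuous_on_derive du ddu); auto.
    + intros; apply Hdu; lra.
    + intros r Hr. unfold ddu, be. field; lra.
    + unfold u, du. rewrite P0, sin_neg, cos_neg, sin_atan_cos_atan. field; lra.
    + unfold u, du. set (h2 := alpha2 - be / R2) in *.
      assert (E : k * sin (phi R2) = h2 * cos (phi R2)).
      { rewrite sin_minus, sin_atan_cos_atan in HT.
        pose proof (cos_atan_pos (h2 / k)) as C.
        apply (Rmult_eq_reg_l (cos (atan (h2 / k)) / k)).
        - apply Rminus_diag_uniq. rewrite <- HT. field; lra.
        - apply Rgt_not_eq. apply Rdiv_lt_0_compat; lra. }
      transitivity (Rpower R2 (- be) * A R2 * (h2 * cos (phi R2) - k * sin (phi R2))).
      * unfold h2. field; lra.
      * rewrite E; ring.
Qed.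

(** * Gaps between consecutive resonances *)

Lemma IVT_lipschitz (f : R -> R) (x y L z : R) :
  x <= y -> 0 < L ->
  (forall s t, x <= s <= y -> x <= t <= y -> Rabs (f t - f s) <= L * Rabs (t - s)) ->
  f x <= z <= f y -> exists t, x <= t <= y /\ f t = z.
Proof.
  intros xy L0 HL Hz.
  destruct (IVT_gen (fun t => f (clamp x y t)) x y z) as [t [Ht E]].
  - intros s. apply continuity_pt_filterlim.
    apply (continuous_eps (fun t => f (clamp x y t)) s). intros eps.
    exists (mkposreal (eps / L) ltac:(apply Rdiv_lt_0_compat; [apply eps|exact L0])).
    intros t Ht. change (Rabs (t - s) < eps / L) in Ht.
    eapply Rle_lt_trans; [apply HL; apply clamp_bounds, xy|].
    eapply Rle_lt_trans; [apply Rmult_le_compat_l; [lra|apply clamp_lipschitz]|].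
    apply (Rmult_lt_compat_l L) in Ht; [|exact L0].
    replace (L * (eps / L)) with (pos eps) in Ht by (field; lra). exact Ht.
  - rewrite !clamp_id by lra. rewrite Rmin_left, Rmax_right; lra.
  - rewrite Rmin_left, Rmax_right in Ht by lra. exists t. rewrite clamp_id in E by lra. auto.
Qed.

(* Consecutive solutions beyond [K] have consecutive values of [Theta / PI]. *)
Lemma phase_quantization_gap (P : R -> Prop) (Theta : R -> R) (K delta S0 C : R) (k : nat -> R) :
  0 < delta -> 1 <= K ->
  (forall x, K <= x -> (P x <-> sin (Theta x) = 0)) ->
  (forall x y, K <= x -> x <= y ->
     Rabs (Theta y - Theta x - (y - x) * delta) <= (y - x) * delta / 2) ->
  (forall x, K <= x -> sin (Theta x) = 0 -> Rabs (Theta x - x * delta + S0 / x) <= C / x ^ 3) ->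
  (forall p q : nat, (1 <= p < q)%nat -> k p < k q) ->
  (forall x, P x <-> exists p : nat, (1 <= p)%nat /\ k p = x) ->
  exists (N : nat) (C' : R), forall p, (N <= p)%nat -> K <= k p /\
    Rabs (k (S p) - k p - PI / delta * (1 - S0 / (k p ^ 2 * delta))) <= C' / k p ^ 3.
Proof.
  intros d0 K1 HP HT HS kinc Hk.
  assert (lower : forall x y, K <= x -> x <= y -> (y - x) * delta / 2 <= Theta y - Theta x <= 2 * ((y - x) * delta)).
  { intros x y Kx xy. pose proof (HT x y Kx xy) as E. apply Rabs_le_between in E.
    assert (0 <= (y - x) * delta) by (apply Rmult_le_pos; lra). lra. }
  assert (lip : forall x, K <= x -> forall s t, x <= s -> x <= t -> Rabs (Theta t - Theta s) <= 2 * delta * Rabs (t - s)).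
  { intros x Kx s t xs xt. destruct (Rle_dec s t) as [st|st].
    - pose proof (lower s t ltac:(lra) st).
      assert (0 <= (t - s) * delta) by (apply Rmult_le_pos; lra).
      rewrite !Rabs_pos_eq; lra.
    - pose proof (lower t s ltac:(lra) ltac:(lra)).
      assert (0 <= (s - t) * delta) by (apply Rmult_le_pos; lra).
      rewrite !Rabs_left1; lra. }
  assert (ivt : forall x y z, K <= x -> x <= y -> Theta x <= z <= Theta y -> exists t, x <= t <= y /\ Theta t = z).
  { intros x y z Kx xy. apply (IVT_lipschitz Theta x y (2 * delta)); try lra.
    intros s t Hs Ht. apply (lip x); lra. }
  pose proof PI_RGT_0 as pi0.
  assert (solZ : forall n : Z, sin (IZR n * PI) = 0) by (intros n; apply sin_eq_0_1; exists n; reflexivity).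
  assert (unbounded : forall x, K <= x -> exists t, x < t /\ P t).
  { intros x Kx. set (n := up (Theta x / PI)).
    assert (Hn : Theta x < IZR n * PI).
    { destruct (archimed (Theta x / PI)) as [H _]. fold n in H.
      apply (Rmult_lt_compat_r PI) in H; [|exact pi0].
      replace (Theta x / PI * PI) with (Theta x) in H by (field; lra). lra. }
    (* Growth at rate at least [delta / 2] brings [Theta] from [Theta x] up to the next multiple
       [n PI] by the point [y]. *)
    set (y := x + 2 * (IZR n * PI - Theta x) / delta).
    assert (Hy : (y - x) * delta / 2 = IZR n * PI - Theta x) by (unfold y; field; lra).
    assert (xy : x <= y).
    { unfold y. assert (0 <= 2 * (IZR n * PI - Theta x) / delta) by (apply Rle_div_r; lra). lra. }
    pose proof (lower x y Kx xy).
    destruct (ivt x y (IZR n * PI) Kx xy) as [t [Ht E]]; [lra|].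
    exists t. split.
    - destruct (Req_dec t x) as [->|]; lra.
    - apply HP; [lra|]. rewrite E. apply solZ. }
  destruct (unbounded K ltac:(lra)) as [x0 [Kx0 Px0]].
  (* [N] is the index of a solution strictly beyond [K], and by monotonicity all later ones lie
     beyond [K] too. *)
  destruct (proj1 (Hk x0) Px0) as [N [N1 HN]].
  assert (Kp : forall p, (N <= p)%nat -> K < k p).
  { intros p Hp. destruct (Nat.eq_dec N p) as [<-|]; [lra|].
    apply Rlt_trans with (k N); [lra|]. apply kinc; lia. }
  assert (gap : forall p, (N <= p)%nat -> Theta (k (S p)) - Theta (k p) = PI).
  { intros p Hp.
    pose proof (Kp p Hp) as Hx. pose proof (Kp (S p) ltac:(lia)) as Hy.
    assert (xy : k p < k (S p)) by (apply kinc; lia).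
    assert (Qx : sin (Theta (k p)) = 0).
    { apply HP; [lra|]. apply Hk. exists p; split; [lia|reflexivity]. }
    assert (Qy : sin (Theta (k (S p))) = 0).
    { apply HP; [lra|]. apply Hk. exists (S p); split; [lia|reflexivity]. }
    apply sin_eq_0_0 in Qx, Qy. destruct Qx as [n En], Qy as [n' En'].
    pose proof (lower (k p) (k (S p)) ltac:(lra) ltac:(lra)) as L.
    assert (0 < (k (S p) - k p) * delta) by (apply Rmult_lt_0_compat; lra).
    assert (nn : (n < n')%Z).
    { apply lt_IZR. apply (Rmult_lt_reg_r PI); [exact pi0|]. lra. }
    destruct (Z.eq_dec n' (n + 1)) as [E|E].
    { rewrite En, En', E, plus_IZR. ring. }
    exfalso.
    (* A skipped multiple [(n + 1) PI] would be attained strictly between [k p] and [k (S p)],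
       giving a solution whose index monotonicity excludes. *)
    assert (n2 : (n + 2 <= n')%Z) by lia. apply IZR_le in n2. rewrite plus_IZR in n2.
    apply (Rmult_le_compat_r PI) in n2; [|lra].
    destruct (ivt (k p) (k (S p)) (IZR (n + 1) * PI) ltac:(lra) ltac:(lra)) as [t [Ht Et]].
    { rewrite En, En', plus_IZR. lra. }
    assert (Pt : P t) by (apply HP; [lra|rewrite Et; apply solZ]).
    apply Hk in Pt. destruct Pt as [q [q1 Eq]].
    rewrite plus_IZR in Et.
    destruct (Nat.lt_trichotomy q p) as [Hq|[Hq|Hq]].
    - pose proof (kinc q p ltac:(lia)). lra.
    - rewrite Hq in Eq. rewrite <- Eq in Et. lra.
    - destruct (Nat.eq_dec q (S p)) as [Hq'|Hq'].
      + rewrite Hq' in Eq. rewrite <- Eq in Et. lra.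
      + pose proof (kinc (S p) q ltac:(lia)). lra. }
  assert (C0 : 0 <= C).
  { apply HP in Px0; [|lra]. pose proof (HS x0 ltac:(lra) Px0) as E.
    assert (x3 : 0 < x0 ^ 3) by (apply pow_lt; lra).
    pose proof (Rle_trans _ _ _ (Rabs_pos _) E) as E'.
    apply (Rmult_le_compat_r (x0 ^ 3)) in E'; [|lra].
    replace (C / x0 ^ 3 * x0 ^ 3) with C in E' by (field; lra). lra. }
  (* Crude bound for a gap: [Theta] rises by [PI] at rate at least [delta / 2]. *)
  set (g := 2 * PI / delta).
  set (M := Rabs S0 * g + 2 * C).
  assert (M0 : 0 <= M).
  { unfold M, g. pose proof (Rabs_pos S0).
    assert (0 < 2 * PI / delta) by (apply Rdiv_lt_0_compat; lra).
    assert (0 <= Rabs S0 * (2 * PI / delta)) by (apply Rmult_le_pos; lra). lra. }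
  exists N, ((Rabs S0 * (M / delta + PI / delta * g) + 2 * C) / delta).
  intros p Hp. pose proof (Kp p Hp) as Hx. pose proof (Kp (S p) ltac:(lia)) as Hy.
  assert (xy : k p < k (S p)) by (apply kinc; lia).
  split; [lra|].
  pose proof (gap p Hp) as G. pose proof (lower (k p) (k (S p)) ltac:(lra) ltac:(lra)) as L.
  assert (sol : forall q, (N <= q)%nat -> sin (Theta (k q)) = 0).
  { intros q Hq. pose proof (Kp q Hq). apply HP; [lra|]. apply Hk. exists q; split; [lia|reflexivity]. }
  pose proof (HS (k p) ltac:(lra) (sol p Hp)) as Qx.
  pose proof (HS (k (S p)) ltac:(lra) (sol (S p) ltac:(lia))) as Qy.
  set (x := k p) in *. set (y := k (S p)) in *. clearbody x y.
  set (D := y - x). assert (D0 : 0 < D) by (unfold D; lra).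
  assert (Dg : D <= g).
  { unfold g. apply Rle_div_r; [lra|]. unfold D. lra. }
  set (i := / x). assert (i0 : 0 < i) by (apply Rinv_0_lt_compat; lra).
  assert (i1 : i <= 1) by (unfold i; rewrite <- Rinv_1; apply Rinv_le_contravar; lra).
  set (j := / y). assert (j0 : 0 < j) by (apply Rinv_0_lt_compat; lra).
  assert (ji : j <= i) by (apply Rinv_le_contravar; lra).
  assert (ij : i - j = D * (i * j)) by (unfold i, j, D; field; lra).
  replace (C / x ^ 3) with (C * i ^ 3) in Qx by (unfold i; field; lra).
  assert (Qy' : Rabs (Theta y - y * delta + S0 / y) <= C * i ^ 3).
  { eapply Rle_trans; [exact Qy|]. replace (C / y ^ 3) with (C * j ^ 3) by (unfold j; field; lra).
    apply Rmult_le_compat_l; [exact C0|]. apply pow_incr; lra. }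
  unfold Rdiv in Qx, Qy'. fold i in Qx. fold j in Qy'.
  assert (ii : i * j <= i * i) by (apply Rmult_le_compat_l; lra).
  assert (ij0 : 0 <= i * j) by (apply Rmult_le_pos; lra).
  (* Subtracting the two quantization relations, with [S0 / x - S0 / y = S0 * D / (x * y)]. *)
  assert (E0 : Rabs (D * delta - PI + S0 * (D * (i * j))) <= 2 * C * i ^ 3).
  { rewrite <- ij. apply Rabs_le_between in Qx, Qy'. apply Rabs_le. unfold D. lra. }
  assert (i3 : i ^ 3 <= i * i) by (assert (0 <= i * i) by nra; simpl; nra).
  assert (E1 : Rabs (D * delta - PI) <= M * (i * i)).
  { replace (D * delta - PI) with ((D * delta - PI + S0 * (D * (i * j))) - S0 * (D * (i * j))) by ring.
    unfold Rminus at 1. eapply Rle_trans; [apply Rabs_triang|].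
    rewrite Rabs_Ropp, !Rabs_mult, (Rabs_pos_eq D), (Rabs_pos_eq i), (Rabs_pos_eq j) by lra.
    assert (Rabs S0 * (D * (i * j)) <= Rabs S0 * (g * (i * i))).
    { apply Rmult_le_compat_l; [apply Rabs_pos|]. apply Rmult_le_compat; lra. }
    assert (2 * C * i ^ 3 <= 2 * C * (i * i)) by (apply Rmult_le_compat_l; lra).
    unfold M. lra. }
  (* Bootstrap: [E1] gives [D = PI / delta + O(i^2)], and [j = i + O(i^2)]. Replacing [D / y] by
     [PI / (delta * x)] then costs [O(i^3)] once multiplied by [S0 * i]. *)
  assert (E2 : Rabs (D * j - PI / delta * i) <= (M / delta + PI / delta * g) * (i * i)).
  { replace (D * j - PI / delta * i) with ((D * delta - PI) * j / delta - PI / delta * (i - j)) by (field; lra).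
    rewrite ij. unfold Rminus at 1. eapply Rle_trans; [apply Rabs_triang|].
    rewrite Rabs_Ropp. rewrite Rmult_plus_distr_r.
    assert (pd : 0 < PI / delta) by (apply Rdiv_lt_0_compat; lra).
    apply Rplus_le_compat.
    - unfold Rdiv. rewrite !Rabs_mult, (Rabs_pos_eq j), (Rabs_pos_eq (/ delta)) by (try apply Rlt_le, Rinv_0_lt_compat; lra).
      replace (M * / delta * (i * i)) with (M * (i * i) * 1 * / delta) by ring.
      apply Rmult_le_compat_r; [apply Rlt_le, Rinv_0_lt_compat, d0|].
      apply Rmult_le_compat; try apply Rabs_pos; lra.
    - assert (0 <= D * (i * j)) by (apply Rmult_le_pos; lra).
      rewrite Rabs_mult, (Rabs_pos_eq (PI / delta)), (Rabs_pos_eq (D * _)) by lra.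
      rewrite Rmult_assoc. apply Rmult_le_compat_l; [lra|]. apply Rmult_le_compat; lra. }
  replace (D - PI / delta * (1 - S0 / (x ^ 2 * delta))) with
    (((D * delta - PI + S0 * (D * (i * j))) - S0 * i * (D * j - PI / delta * i)) * / delta)
    by (unfold i; field; lra).
  replace (_ / x ^ 3) with ((2 * C * i ^ 3 + Rabs S0 * i * ((M / delta + PI / delta * g) * (i * i))) * / delta)
    by (unfold i; field; lra).
  rewrite Rabs_mult, (Rabs_pos_eq (/ delta)) by (apply Rlt_le, Rinv_0_lt_compat, d0).
  apply Rmult_le_compat_r; [apply Rlt_le, Rinv_0_lt_compat, d0|].
  unfold Rminus at 1. eapply Rle_trans; [apply Rabs_triang|]. apply Rplus_le_compat; [exact E0|].
  rewrite Rabs_Ropp, !Rabs_mult, (Rabs_pos_eq i) by lra.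
  apply Rmult_le_compat_l; [|exact E2]. apply Rmult_le_pos; [apply Rabs_pos|lra].
Qed.

(** Adds the variation of [atan (h2 / k)] to the phase estimate. The second lower bound on [K] makes
    the total relative error at most one half, so the shifted phase grows at a rate comparable to
    [b - a]. *)
Lemma phase_shift_sub_estimate (V : R -> R) (a b h1 h2 c K : R) :
  a < b -> 1 <= K -> (forall r, a <= r <= b -> Rabs (V r) <= c) -> 2 * c * (b - a) <= K ->
  2 * (2 * (Rabs h1 + c * (b - a)) + 2 * c * (b - a) ^ 2 + Rabs h2) <= K * (b - a) ->
  forall k k' phi phi', K <= k -> k <= k' ->
  is_phase V a b h1 k phi -> is_phase V a b h1 k' phi' ->
  Rabs ((phi' b - atan (h2 / k')) - (phi b - atan (h2 / k)) - (k' - k) * (b - a)) <= (k' - k) * (b - a) / 2.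
Proof.
  intros ab K1 Vb HK1 HK2 k k' phi phi' Kk kk' Hphi Hphi'.
  pose proof (phase_sub_estimate V a b h1 c k k' phi phi' ltac:(lra) ltac:(lra) kk' Vb ltac:(lra) Hphi Hphi' b ltac:(lra)) as E.
  set (D := k' - k) in *. assert (D0 : 0 <= D) by (unfold D; lra).
  assert (c0 : 0 <= c) by (eapply Rle_trans; [apply Rabs_pos|apply (Vb a); lra]).
  set (i := / k) in *. assert (i0 : 0 < i) by (apply Rinv_0_lt_compat; lra).
  assert (i1 : i <= 1) by (unfold i; rewrite <- Rinv_1; apply Rinv_le_contravar; lra).
  assert (Et : Rabs (atan (h2 / k) - atan (h2 / k')) <= Rabs h2 * (D * i)).
  { eapply Rle_trans; [apply Rabs_sub_atan_le|].
    replace (h2 / k - h2 / k') with (h2 * (D * (i * / k'))) by (unfold i, D; field; lra).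
    assert (0 < / k') by (apply Rinv_0_lt_compat; lra).
    assert (/ k' <= 1) by (rewrite <- Rinv_1; apply Rinv_le_contravar; lra).
    assert (0 <= i * / k') by (apply Rmult_le_pos; lra).
    rewrite Rabs_mult, (Rabs_pos_eq (D * _)) by (apply Rmult_le_pos; lra).
    apply Rmult_le_compat_l; [apply Rabs_pos|]. apply Rmult_le_compat_l; [exact D0|].
    rewrite <- (Rmult_1_r i) at 2. apply Rmult_le_compat_l; lra. }
  set (Q := 2 * (Rabs h1 + c * (b - a))) in *. set (Q' := 2 * c * (b - a) ^ 2) in *.
  assert (Q0 : 0 <= Q).
  { unfold Q. pose proof (Rabs_pos h1). assert (0 <= c * (b - a)) by (apply Rmult_le_pos; lra). lra. }
  replace (Q / k ^ 2 + Q' / k) with (Q * (i * i) + Q' * i) in E by (unfold i; field; lra).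
  assert (E' : Rabs (phi' b - phi b - D * (b - a)) <= D * (Q * i + Q' * i)).
  { eapply Rle_trans; [exact E|]. apply Rmult_le_compat_l; [exact D0|].
    apply Rplus_le_compat_r. apply Rmult_le_compat_l; [exact Q0|].
    rewrite <- (Rmult_1_r i) at 3. apply Rmult_le_compat_l; lra. }
  assert (F : 2 * (Q + Q' + Rabs h2) * i <= b - a).
  { replace (b - a) with (k * (b - a) * i) by (unfold i; field; lra).
    apply Rmult_le_compat_r; [lra|]. eapply Rle_trans; [exact HK2|].
    apply Rmult_le_compat_r; lra. }
  apply (Rmult_le_compat_l D) in F; [|exact D0].
  apply Rabs_le_between in E', Et. apply Rabs_le. lra.
Qed.

(** * Application to the potential [m / r^2] *)

Lemma Rabs_div_pow_le (m a r : R) (n : nat) :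
  0 < a -> a <= r -> Rabs (m / r ^ n) <= Rabs m / a ^ n.
Proof.
  intros a0 ar. unfold Rdiv. rewrite Rabs_mult.
  assert (0 < a ^ n) by (apply pow_lt; lra).
  assert (a ^ n <= r ^ n) by (apply pow_incr; lra).
  apply Rmult_le_compat_l; [apply Rabs_pos|].
  rewrite Rabs_pos_eq by (apply Rlt_le, Rinv_0_lt_compat; lra).
  apply Rinv_le_contravar; lra.
Qed.

Theorem theorem3p10 :
  forall (d l : nat) (R1 R2 alpha1 alpha2 : R),
    (2 <= d)%nat -> 0 < R1 -> R1 < R2 -> 0 < alpha1 -> 0 < alpha2 ->
    forall k : nat -> R,
      resonance_sequence d l R1 R2 alpha1 alpha2 k ->
      exists E : nat -> R,
        is_bigO E (fun p => / (k p * Rmax R1 R2) ^ 3) /\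
        forall p : nat, (1 <= p)%nat ->
          k (S p) - k p =
            PI / (R2 - R1) *
              (1 - S_coef d l R1 R2 alpha1 alpha2 / ((k p) ^ 2 * (R2 - R1)) + E p).
Proof.
  intros d l R1 R2 alpha1 alpha2 _ R10 R12 _ _ k [kinc kres].
  set (m := liouville_coef d l). set (be := (INR d - 1) / 2).
  set (V := fun r => m / r ^ 2).
  set (h1 := alpha1 + be / R1). set (h2 := alpha2 - be / R2).
  set (c := Rabs m / R1 ^ 2).
  assert (Vb : forall r, R1 <= r <= R2 -> Rabs (V r) <= c).
  { intros r Hr. apply Rabs_div_pow_le; lra. }
  assert (c0 : 0 <= c) by (eapply Rle_trans; [apply Rabs_pos|apply (Vb R1); lra]).
  assert (HV : forall r, R1 <= r <= R2 -> is_derive V r (- 2 * m / r ^ 3)).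
  { intros r Hr. unfold V. auto_derive; [nra|]. field; lra. }
  set (delta := R2 - R1). assert (d0 : 0 < delta) by (unfold delta; lra).
  set (H := 2 * (2 * (Rabs h1 + c * delta) + 2 * c * delta ^ 2 + Rabs h2)).
  assert (H0 : 0 <= H / delta).
  { apply Rle_div_r; [lra|]. unfold H. pose proof (Rabs_pos h1). pose proof (Rabs_pos h2).
    assert (0 <= c * delta) by (apply Rmult_le_pos; lra).
    assert (0 <= c * delta ^ 2) by (apply Rmult_le_pos; [lra|apply pow_le; lra]). lra. }
  assert (cd0 : 0 <= 2 * c * delta) by (apply Rmult_le_pos; lra).
  (* The summands secure in turn [1 <= K], the contraction condition [2 * c * delta <= K], and
     [H <= K * delta]. *)
  set (K := 1 + 2 * c * delta + H / delta).
  assert (HK : H <= K * delta).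
  { replace H with (H / delta * delta) at 1 by (field; lra). apply Rmult_le_compat_r; unfold K; lra. }
  (* One phase is selected for each [x >= K]; below [K] the zero function is a placeholder. *)
  destruct (ClassicalEpsilon.choice
    (fun x phi => K <= x -> is_phase V R1 R2 h1 x phi)) as [Phi HPhi].
  { intros x. destruct (Rle_dec K x) as [Kx|Kx]; [|exists (fun _ => 0); tauto].
    destruct (phase_exists V R1 R2 h1 x c) as [phi Hphi]; [lra|unfold K in Kx; lra| |exact Vb| |].
    - exact (continuous_on_derive _ _ _ _ HV).
    - fold delta. unfold K in Kx; lra.
    - exists phi; auto. }
  destruct (phase_quantization_gap (resonance d l R1 R2 alpha1 alpha2)
    (fun x => Phi x R2 - atan (h2 / x)) K delta (S_coef d l R1 R2 alpha1 alpha2)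
    ((c ^ 2 + c * (Rabs (- 2 * m) / R1 ^ 3) + Rabs (6 * m) / R1 ^ 4) * delta
      + Rabs h1 ^ 3 + Rabs h2 ^ 3 + c * (Rabs h1 + Rabs h2) + Rabs (- 2 * m) / R1 ^ 3) k)
    as [N [C HC]]; try assumption.
  - unfold K; lra.
  - intros x Kx. split.
    + apply resonance_phase; try assumption; [unfold K in Kx; lra|apply HPhi, Kx].
    + apply phase_resonance; try assumption; [unfold K in Kx; lra|apply HPhi, Kx].
  - intros x y Kx xy. apply (phase_shift_sub_estimate V R1 R2 h1 h2 c K); try assumption.
    + unfold K; lra.
    + fold delta; unfold K; lra.
    + apply HPhi, Kx.
    + apply HPhi; lra.
  - intros x Kx Hx.
    (* The Robin shifts contribute [be * delta / (R1 * R2)] and half the integral of [V] contributes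
       [m * delta / (2 * R1 * R2)]; since [m = ((2l + d - 2)^2 - 1) / 4], [be + m / 2] is
       [K_coef d l]. *)
    replace (S_coef d l R1 R2 alpha1 alpha2) with (h1 + h2 + (- m / R2 - - m / R1) / 2)
      by (unfold S_coef, K_coef, h1, h2, m, liouville_coef, be; field; lra).
    apply (phase_asymptotics V (fun r => - 2 * m / r ^ 3) (fun r => 6 * m / r ^ 4) (fun r => - m / r)
      R1 R2 h1 h2); try assumption.
    + lra.
    + unfold K in Kx; lra.
    + intros r Hr. unfold V. auto_derive; [lra|]. field; lra.
    + intros r Hr. auto_derive; [|field; lra]. apply Rgt_not_eq, (pow_lt r 3); lra.
    + intros r Hr. apply Rabs_div_pow_le; lra.
    + intros r Hr. apply Rabs_div_pow_le; lra.
    + apply HPhi, Kx.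
  - set (S0 := S_coef d l R1 R2 alpha1 alpha2) in *.
    pose proof PI_RGT_0 as pi0.
    assert (k0 : forall p, (1 <= p)%nat -> 0 < k p).
    { intros p Hp. assert (resonance d l R1 R2 alpha1 alpha2 (k p)) as [Hpos _]; [|exact Hpos].
      apply kres. exists p; auto. }
    (* The remainder is obtained by solving the gap formula for it, so the identity is exact for
       every [p >= 1] and only the bound is asymptotic. *)
    exists (fun p => (k (S p) - k p) * delta / PI - 1 + S0 / (k p ^ 2 * delta)). split.
    (* [delta / PI] comes from factoring [PI / delta] out of the gap, and [R2 ^ 3] compensates the
       maximal radius, which is [R2]. *)
    + exists (delta / PI * (C * R2 ^ 3)), N. intros p Hp.
      destruct (HC p Hp) as [Kp E].
      assert (kp : 0 < k p) by (unfold K in Kp; lra).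
      rewrite Rmax_right by lra.
      rewrite (Rabs_pos_eq (/ _)) by (apply Rlt_le, Rinv_0_lt_compat, pow_lt, Rmult_lt_0_compat; lra).
      replace (_ - 1 + _) with (delta / PI * (k (S p) - k p - PI / delta * (1 - S0 / (k p ^ 2 * delta))))
        by (field; lra).
      replace (_ * / _) with (delta / PI * (C / k p ^ 3)) by (field; lra).
      assert (0 < delta / PI) by (apply Rdiv_lt_0_compat; lra).
      rewrite Rabs_mult, (Rabs_pos_eq (delta / PI)) by lra.
      apply Rmult_le_compat_l; [lra|exact E].
    + intros p Hp. pose proof (k0 p Hp). field. lra.
Qed.
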